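(* Let $X$ and $Y$ be real Hilbert spaces, $A\in\mathcal L(X,Y)$, $K_r\subset X$ a bounded closed convex set containing $0$, and $P_r=\operatorname{cone}(K_r)$. Then for any $b\in Y$: (i) The following three assertions are equivalent: $b\in\overline{A(P_r)}$; for all $y\in Y$, $\sigma_{K_r}(A^*y)=0$ implies $\langle b,y\rangle_Y\le 0$; for all $y\in Y$, $A^*y\in P_r^\circ$ implies $\langle b,y\rangle_Y\le 0$. (ii) $b\in A(P_r)$ if and only if there exists $C>0$ such that for all $y\in Y$, $\langle b,y\rangle_Y\le C\,\sigma_{K_r}(A^*y)$.
   Context: $\mathcal L(X,Y)$ is the space of bounded linear operators; $A^*\in\mathcal L(Y,X)$ is the Hilbert adjoint. For a set $C\subset X$ containing $0$, $\operatorname{cone}(C)=\{\lambda c : \lambda\ge 0,\ c\in C\}$ (the cone $P_r$ is convex but not necessarily closed). $\sigma_{K_r}(x)=\sup_{v\in K_r}\langle x,v\rangle_X$ is the support function of $K_r$. $P_r^\circ=\{x\in X : \langle x,v\rangle_X\le 0\ \text{for all } v\in P_r\}$ is the polar cone. $A(P_r)=\{Ax : x\in P_r\}$. *)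

(* Defs.v *)
From HB Require Import structures.
From mathcomp Require Import all_boot all_order all_algebra.
From mathcomp Require Import all_classical all_reals all_analysis.

Set Implicit Arguments.
Unset Strict Implicit.
Unset Printing Implicit Defensive.

Import Order.TTheory GRing.Theory Num.Theory.
Import numFieldNormedType.Exports.

Local Open Scope classical_set_scope.
Local Open Scope ring_scope.

(* [{dot V for idfun}] is the type of symmetric positive definite bilinear
   forms on [V]; [inner_normE] says that it induces the norm of [V]. *)
HB.mixin Record NormedModule_hasInner (R : realType) V
    & NormedModule R V := {
  inner : {dot V for idfun};
  inner_normE : forall x : V, `|x| ^+ 2 = inner x x }.

#[short(type="hilbertType")]
HB.structure Definition Hilbert (R : realType) :=
  {V of CompleteNormedModule R V & NormedModule_hasInner R V}.

Definition bounded_operator (R : realType) (X Y : normedModType R)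
    (A : X -> Y) : Prop :=
  exists C : R, forall x : X, `|A x| <= C * `|x|.

(* For a bounded linear [A] between Hilbert spaces, the Riesz representation
   theorem gives exactly one point in the set below; the default value [0] of
   [xget] is then irrelevant. *)
Definition adjoint (R : realType) (X Y : hilbertType R) (A : X -> Y)
    (y : Y) : X :=
  xget 0 [set z : X | forall x : X, inner (A x) y = inner x z].

Definition cone (R : realType) (X : lmodType R) (C : set X) : set X :=
  [set x | exists l : R, exists c : X, [/\ 0 <= l, C c & x = l *: c]].

(* [sup] is the real-valued supremum, a junk value on sets that are empty or
   not bounded above; for [K] nonempty and bounded it is the genuine one. *)
Definition support_fun (R : realType) (X : hilbertType R) (K : set X)
    (x : X) : R :=
  sup [set inner x v | v in K].

Definition polar (R : realType) (X : hilbertType R) (P : set X) : set X :=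
  [set x | forall v : X, P v -> inner x v <= 0].

(* Main.v *)
Require Import Defs.
From HB Require Import structures.
From mathcomp Require Import all_boot all_order all_algebra.
From mathcomp Require Import all_classical all_reals all_analysis.
From mathcomp Require Import ring lra.

Set Implicit Arguments.
Unset Strict Implicit.
Unset Printing Implicit Defensive.

Import Order.TTheory GRing.Theory Num.Theory.
Import numFieldNormedType.Exports.

Local Open Scope classical_set_scope.
Local Open Scope ring_scope.

(** Both parts are separation arguments in the space [Y], and both separations
    rest on one fact about Hilbert spaces: a decreasing sequence of closed
    convex sets that all meet a fixed ball has a common point
    ([nearest_point_decreasing]).  Almost nearest points of these sets to a
    given centre form a Cauchy sequence, because the midpoint of two of them
    stays in the set, hence stays far from the centre, and the parallelogram
    identity then bounds their distance.

    Applied to a constant sequence, this fact gives the nearest point of a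
    closed convex set ([nearest_point]), hence the strict separation of a point
    from such a set ([separation]) and the Riesz representation theorem
    ([riesz_representation]), which makes the adjoint satisfy its defining
    identity ([adjoint_inner]).  Applied to the sets of those [x] in [K] with
    [`|A x - b| <= 1 / n.+1], it shows that [A] maps bounded closed convex sets
    to closed sets ([closed_image]); it thus does the work of the weak
    compactness of [K].

    For the first part, [0] belongs to [K], so that the support function of [K]
    is nonnegative, and it vanishes exactly on the polar cone of [cone K].  If
    [b] is in the closure of [A (cone K)], then [b] lies in each closed
    half-space that contains this cone.  If it is not, a separating [y]
    satisfies [0 < inner b y], and a linear form that is bounded above on a cone
    is nonpositive there, so that [adjoint A y] is in the polar cone.

    For the second part, if [b = A (l *: v)] with [v] in [K], then [inner b y] is
    [l] times [inner v (adjoint A y)], which the support function bounds.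
    Conversely, [C * support_fun K (adjoint A y)] is the value at [y]
    of the support function of [C A(K)].  The inequality thus says that no
    hyperplane strictly separates [b] from this set; as the set is closed and
    convex, it contains [b]. *)

(** * The inner product *)

Section InnerProduct.
Variables (R : realType) (V : hilbertType R).
Implicit Types u v w : V.

Lemma innerC u v : inner u v = inner v u.
Proof. by rewrite hermC expr0 mul1r. Qed.

Lemma innerDl u v w : inner (u + v) w = inner u w + inner v w.
Proof. exact: linearDl. Qed.

Lemma innerZl (a : R) u v : inner (a *: u) v = a * inner u v.
Proof. exact: linearZl_LR. Qed.

Lemma innerNl u v : inner (- u) v = - inner u v.
Proof. exact: linearNl. Qed.

Lemma innerBl u v w : inner (u - v) w = inner u w - inner v w.
Proof. exact: linearBl. Qed.

Lemma innerDr u v w : inner w (u + v) = inner w u + inner w v.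
Proof. exact: linearDr. Qed.

Lemma innerZr (a : R) u v : inner v (a *: u) = a * inner v u.
Proof. by rewrite innerC innerZl innerC. Qed.

Lemma innerBr u v w : inner w (u - v) = inner w u - inner w v.
Proof. exact: linearBr. Qed.

Lemma inner0r u : inner u 0 = 0.
Proof. exact: linear0r. Qed.

Lemma inner_eq0 u : (inner u u == 0) = (u == 0).
Proof. by rewrite -inner_normE sqrf_eq0 normr_eq0. Qed.

Lemma inner_normB u v :
  `|u - v| ^+ 2 = `|u| ^+ 2 - 2 * inner u v + `|v| ^+ 2.
Proof.
by rewrite !inner_normE !(innerBl, innerBr) (innerC v u); ring.
Qed.

Lemma parallelogram u v :
  `|u - v| ^+ 2 = 2 * `|u| ^+ 2 + 2 * `|v| ^+ 2
                  - 4 * `|2^-1 *: (u + v)| ^+ 2.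
Proof.
rewrite !inner_normE !(innerBl, innerBr, innerZl, innerZr, innerDl, innerDr).
by rewrite (innerC v u); field.
Qed.

Lemma cauchy_schwarz u v : inner u v <= `|u| * `|v|.
Proof.
have [->|u0] := eqVneq u 0; first by rewrite innerC inner0r mulr_ge0.
have [->|v0] := eqVneq v 0; first by rewrite inner0r mulr_ge0.
have uv0 : 0 < `|u| * `|v| by rewrite mulr_gt0 ?normr_gt0.
(* The squared norm below is twice [`|u| * `|v|] times the difference of the two
   sides. *)
have := sqr_ge0 `| `|v| *: u - `|u| *: v|.
rewrite inner_normB !normrZ innerZl innerZr !normr_id => h.
rewrite -subr_ge0 -(pmulr_rge0 _ uv0); lra.
Qed.

Lemma norm_cauchy_schwarz u v : `|inner u v| <= `|u| * `|v|.
Proof.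
rewrite ler_norml cauchy_schwarz andbT -normrN.
rewrite lerNl; apply: le_trans (cauchy_schwarz _ _).
by rewrite innerNl.
Qed.

End InnerProduct.

(** * Continuity and closed sets *)

Lemma closed_sublevel (R : realFieldType) (T : topologicalType) (f : T -> R)
    (r : R) :
  continuous f -> closed [set x | f x <= r].
Proof.
move=> cf; apply: (@preimage_closed _ _ f [set y | y <= r]) (@closed_le R r).
by move=> x _; exact: cf.
Qed.

Lemma closed_dist_le (R : realFieldType) (T : topologicalType)
    (V : normedModType R) (f : T -> V) (p : V) (r : R) :
  continuous f -> closed [set x | `|f x - p| <= r].
Proof.
move=> cf; apply: (closed_sublevel (f := fun x => `|f x - p|)) => x.
by apply: cvg_norm; apply: cvgB; [exact: cf | exact: cvg_cst].
Qed.

Lemma bounded_operator_continuous (R : realType) (V W : normedModType R)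
    (f : {linear V -> W}) : bounded_operator f -> continuous f.
Proof.
move=> [C hC]; apply: bounded_linear_continuous.
apply/linear_boundedP; near=> r => x; apply: le_trans (hC x) _.
by apply: ler_wpM2r => //; near: r; exact: nbhs_pinfty_ge.
Unshelve. all: by end_near. Qed.

Lemma inner_continuous (R : realType) (V : hilbertType R) (v : V) :
  continuous (fun u : V => inner u v).
Proof.
have lin : linear (fun u : V => inner u v : R^o).
  by move=> a x y; rewrite innerDl innerZl.
pose f : {linear V -> R^o} := HB.pack (fun u : V => inner u v : R^o)
  (GRing.isLinear.Build _ _ _ _ _ lin).
apply: (@bounded_operator_continuous _ _ _ f).
by exists `|v| => u; rewrite mulrC norm_cauchy_schwarz.
Qed.

(** * Convex sets *)

Lemma convex_setP (R : numDomainType) (V : lmodType R) (D : set V) :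
  convex_set D <->
  (forall (t : R) x y, 0 <= t <= 1 -> D x -> D y -> D (t *: x + (1 - t) *: y)).
Proof.
split => [cD t x y /andP[t0 t1] Dx Dy | cD x y t /set_mem Dx /set_mem Dy].
  by have := cD x y (Itv01 t0 t1) (mem_set Dx) (mem_set Dy); rewrite inE.
by apply/mem_set/cD => //; apply/andP; split.
Qed.

Section ConvexImage.
Variables (R : numFieldType) (V W : normedModType R).

Lemma convex_setI (C D : set V) :
  convex_set C -> convex_set D -> convex_set (C `&` D).
Proof.
move=> /convex_setP cC /convex_setP cD; apply/convex_setP.
by move=> t x y t01 [Cx Dx] [Cy Dy]; split; [exact: cC | exact: cD].
Qed.

Lemma convex_preimage_ball (f : {linear V -> W}) (p : W) (r : R) :
  convex_set [set x | `|f x - p| <= r].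
Proof.
apply/convex_setP => t x y /andP[t0 t1] /= xr yr.
have -> : f (t *: x + (1 - t) *: y) - p = t *: (f x - p) + (1 - t) *: (f y - p).
  by rewrite linearD !linearZ /= !scalerBr addrACA -opprD -scalerDl subrKC
             scale1r.
apply: le_trans (ler_normD _ _) _.
rewrite !normrZ (ger0_norm t0) ger0_norm ?subr_ge0 //.
have -> : r = t * r + (1 - t) * r by rewrite -mulrDl subrKC mul1r.
by apply: lerD; apply: ler_wpM2l => //; rewrite subr_ge0.
Qed.

Lemma convex_image (f : {linear V -> W}) (C : set V) :
  convex_set C -> convex_set (f @` C).
Proof.
move=> /convex_setP cC; apply/convex_setP => t _ _ t01 [x Cx <-] [y Cy <-].
by exists (t *: x + (1 - t) *: y); [exact: cC | rewrite linearD !linearZ].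
Qed.

Lemma convex_closure (C : set V) : convex_set C -> convex_set (closure C).
Proof.
move=> /convex_setP cC; apply/convex_setP => t x y t01 clx cly B nB.
have : \forall u \near x & v \near y, B (t *: u + (1 - t) *: v).
  have : (fun z : V * V => t *: z.1 + (1 - t) *: z.2) z @[z --> (x, y)]
      --> t *: x + (1 - t) *: y.
    apply: cvgD; apply: cvgZl_tmp; [exact: cvg_fst | exact: cvg_snd].
  exact.
move=> [[P Q] /= [nP nQ] PQ].
have [u [Cu Pu]] := clx _ nP; have [v [Cv Qv]] := cly _ nQ.
by exists (t *: u + (1 - t) *: v); split; [exact: cC | exact: (PQ (u, v))].
Qed.

End ConvexImage.

Lemma convex_cone (R : realType) (V : lmodType R) (C : set V) :
  convex_set C -> convex_set (cone C).
Proof.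
move=> /convex_setP cC; apply/convex_setP.
move=> t _ _ /andP[t0 t1] [l [c [l0 Cc ->]]] [m [d [m0 Cd ->]]].
(* A convex combination of [l *: c] and [m *: d] is [s] times a convex
   combination of [c] and [d], unless its total weight [s] vanishes. *)
pose s := t * l + (1 - t) * m.
have tl0 : 0 <= t * l by rewrite mulr_ge0.
have tm0 : 0 <= (1 - t) * m by rewrite mulr_ge0 ?subr_ge0.
have s0 : 0 <= s by exact: addr_ge0.
have [sE|sN] := eqVneq s 0.
  exists 0, c; split=> //; move/eqP: sE.
  rewrite paddr_eq0 // => /andP[/eqP tl /eqP tm].
  by rewrite !scalerA tl tm !scale0r addr0.
exists s, ((t * l / s) *: c + (1 - t * l / s) *: d); split=> //.
  apply: cC => //; rewrite divr_ge0 //= ler_pdivrMr ?mul1r ?lt0r ?sN //.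
  by rewrite lerDl.
have -> : 1 - t * l / s = (1 - t) * m / s.
  by rewrite -{1}(divff sN) -mulrBl /s addrC addKr.
by rewrite scalerDr !scalerA ![s * (_ / s)]mulrC !divfK.
Qed.

(** * Nearest points, separation and the Riesz representation theorem *)

Section NearestPoint.
Variables (R : realType) (V : hilbertType R).

(** The second conclusion says that [x] is as near to [p] as any bound on the
    distances to the sets [C n] allows: for a constant sequence, [x] is the
    nearest point.  The common radius [s] is what keeps the distances from [p]
    to the sets from tending to infinity. *)
Lemma nearest_point_decreasing (C : nat -> set V) (p : V) (s : R) :
  (forall n, closed (C n)) -> (forall n, convex_set (C n)) ->
  (forall n, C n.+1 `<=` C n) ->
  (forall n, exists2 x, C n x & `|x - p| <= s) ->
  exists2 x, (forall n, C n x) &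
    forall r, (forall n, exists2 y, C n y & `|y - p| <= r) -> `|x - p| <= r.
Proof.
move=> Ccl Ccv Cdec Cs.
have Cle m n : (m <= n)%N -> C n `<=` C m.
  move=> /subnK <-; elim: (n - m)%N => // k IH.
  by rewrite addSn; exact: subset_trans (Cdec _) IH.
(* The infimum [rho] of [S] is the limit of the squared distances from [p] to
   the sets [C n]; squares are what the parallelogram identity speaks of. *)
pose S := [set r : R | forall n, exists2 y, C n y & `|y - p| ^+ 2 <= r].
have Ssq r : (forall n, exists2 y, C n y & `|y - p| <= r) -> S (r ^+ 2).
  move=> h n; have [y Cy yr] := h n; exists y => //.
  by rewrite ler_sqr ?nnegrE // (le_trans _ yr).
have Sinf : has_inf S.
  split; first by exists (s ^+ 2); exact: Ssq.
  by exists 0 => r /(_ 0%N)[y _]; apply: le_trans; exact: sqr_ge0.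
pose rho := inf S.
have : forall n, exists x, C n x /\ `|x - p| ^+ 2 <= rho + n.+1%:R^-1.
  have nV n : 0 < n.+1%:R^-1 :> R by rewrite invr_gt0.
  move=> n; have [r Sr rlt] := inf_adherent (nV n) Sinf.
  have [y Cy yr] := Sr n; exists y; split=> //.
  exact: le_trans yr (ltW rlt).
move=> /choice[x /all_and2[Cx xle]].
have xnear e : 0 < e -> \forall n \near \oo, `|x n - p| ^+ 2 <= rho + e.
  move=> e0; near=> n; apply: le_trans (xle n) _.
  rewrite lerD2l ltW //; near: n.
  exact: (near_infty_natSinv_lt (PosNum e0)).
have xcvg : cvg (x @ \oo).
  apply: cauchy_cvg; apply/cauchy_ballP => e e0.
  (* For large [m] and [n], the squared distances of [x m] and [x n] to [p] are at
     most [rho + d], and that of their midpoint is above [rho - d]: by the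
     parallelogram identity, [`|x m - x n| ^+ 2] is below
     [4 (rho + d) - 4 (rho - d) = 8 d], which is less than [e ^+ 2]. *)
  pose d : R := e ^+ 2 / 16.
  have d0 : 0 < d by rewrite divr_gt0 ?exprn_gt0.
  have [N CN] : exists N, forall y, C N y -> rho - d < `|y - p| ^+ 2.
    apply: contrapT => hN.
    have : S (rho - d).
      move=> n; apply: contrapT => hn; apply: hN; exists n => y Cy.
      by rewrite ltNge; apply/negP => yle; apply: hn; exists y.
    move=> /(ge_inf (proj2 Sinf)); rewrite -/rho; lra.
  have xN : \forall n \near \oo, C N (x n) /\ `|x n - p| ^+ 2 <= rho + d.
    near=> n; split; last by near: n; exact: xnear.
    by apply: (Cle N n) => //; near: n; exact: nbhs_infty_ge.
  rewrite near_map2; near=> m n.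
  have [Cm xm] : C N (x m) /\ `|x m - p| ^+ 2 <= rho + d by near: m.
  have [Cn xn] : C N (x n) /\ `|x n - p| ^+ 2 <= rho + d by near: n.
  rewrite -ball_normE /ball_ /= -ltr_sqr ?nnegrE ?(ltW e0) //.
  have -> : x m - x n = (x m - p) - (x n - p) by rewrite opprB addrA subrK.
  rewrite parallelogram.
  have -> : 2^-1 *: (x m - p + (x n - p)) =
            (2^-1 *: x m + (1 - 2^-1) *: x n) - p.
    have -> : 1 - 2^-1 = 2^-1 :> R by field.
    rewrite -scalerDr addrACA -opprD scalerBr; congr (_ - _).
    by rewrite -(mulr2n p) -[p *+ 2]scaler_nat scalerA mulVf ?scale1r.
  have /CN : C N (2^-1 *: x m + (1 - 2^-1) *: x n).
    by apply: (convex_setP _).1 => //; lra.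
  have -> : e ^+ 2 = 16 * d by rewrite /d; field.
  lra.
exists (lim (x @ \oo)).
  move=> n; apply: (closed_cvg (C n)) xcvg => //.
  by near=> m; apply: (Cle n m) => //; near: m; exact: nbhs_infty_ge.
move=> r hr; have r0 : 0 <= r.
  by have [y _] := hr 0%N; apply: le_trans.
rewrite -ler_sqr ?nnegrE //.
apply: le_trans (ge_inf (proj2 Sinf) (Ssq _ hr)); rewrite -/rho.
apply/ler_addgt0Pr => e e0.
have re : 0 <= rho + e.
  apply: addr_ge0 (ltW e0); apply: lb_le_inf (proj1 Sinf) _ => q.
  by move=> /(_ 0%N)[y _]; apply: le_trans; exact: sqr_ge0.
rewrite -(sqr_sqrtr re) ler_sqr ?nnegrE ?sqrtr_ge0 //.
apply: (closed_cvg (fun y : V => `|y - p| <= Num.sqrt (rho + e))) xcvg.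
  by apply: (closed_dist_le (f := id)) => z; exact: cvg_id.
near=> n; rewrite -ler_sqr ?nnegrE ?sqrtr_ge0 // (sqr_sqrtr re).
by near: n; exact: xnear.
Unshelve. all: by end_near. Qed.

(** The variational inequality characterises the nearest point to [p], and is
    the form in which separation and the Riesz theorem use it. *)
Lemma nearest_point (D : set V) (p : V) :
  closed D -> convex_set D -> D !=set0 ->
  exists2 x, D x & forall y, D y -> inner (p - x) (y - x) <= 0.
Proof.
move=> clD cD [y0 Dy0].
have [|x Dx xmin] := @nearest_point_decreasing (fun=> D) p `|y0 - p|
  (fun=> clD) (fun=> cD) (fun=> @subset_refl _ _).
  by move=> _; exists y0.
exists x; first exact: Dx 0%N.
move=> y Dy; rewrite leNgt; apply/negP => a0.
(* Moving from [x] towards [y] by the fraction [t] changes the squared distance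
   to [p] by [t (t b - 2 a)]; the choice of [t] below keeps [t] in [0, 1] and
   makes [t b <= a], so that this change is negative, also when [b = 0]. *)
set a := inner _ _ in a0; pose b := `|y - x| ^+ 2; pose t := a / (a + b).
have b0 : 0 <= b by exact: sqr_ge0.
have ab0 : 0 < a + b by exact: ltr_pwDl.
have t0 : 0 < t by exact: divr_gt0.
have t1 : t <= 1 by rewrite ler_pdivrMr // mul1r lerDl.
have Dt : D (t *: y + (1 - t) *: x).
  by apply: (convex_setP _).1 => //; [rewrite (ltW t0) t1 | exact: Dx 0%N].
have : `|x - p| ^+ 2 <= `|(t *: y + (1 - t) *: x) - p| ^+ 2.
  by rewrite ler_sqr ?nnegrE //; apply: xmin => _; eexists; first exact: Dt.
have -> : t *: y + (1 - t) *: x - p = t *: (y - x) - (p - x).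
  by rewrite opprB scalerBl scale1r scalerBr addrA addrA addrAC.
rewrite [`|t *: _ - _| ^+ 2]inner_normB normrZ exprMn (ger0_norm (ltW t0)).
rewrite innerZl (innerC (y - x)) -/a -/b distrC.
have tb : t * b <= a.
  by rewrite /t mulrAC ler_pdivrMr // ler_wpM2l ?(ltW a0) // lerDr ltW.
have := ltW t0; have : t * (t * b) <= t * a by rewrite ler_pM2l.
have : 0 < t * a by exact: mulr_gt0.
rewrite expr2; lra.
Qed.

(** The hyperplane through the nearest point [x] orthogonal to [b - x]
    separates: [b] exceeds the level of [x] by [`|b - x| ^+ 2]. *)
Lemma separation (D : set V) (b : V) :
  closed D -> convex_set D -> D !=set0 -> ~ D b ->
  exists y c, c < inner b y /\ forall q, D q -> inner q y <= c.
Proof.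
move=> clD cD D0 Db; have [x Dx xP] := nearest_point b clD cD D0.
exists (b - x), (inner x (b - x)); split.
  rewrite -subr_gt0 -innerBl -inner_normE exprn_gt0 // normr_gt0 subr_eq0.
  by apply: contra_notN Db => /eqP ->.
by move=> q /xP; rewrite innerC innerBl subr_le0.
Qed.

(** The nearest point [x] to [0] of the affine hyperplane [f = 1] is orthogonal
    to the kernel of [f], because the hyperplane contains [x + k] and [x - k]
    for every [k] in the kernel; the vector sought is a multiple of [x]. *)
Lemma riesz_representation (f : {linear V -> R^o}) :
  continuous f -> exists z, forall x, f x = inner x z.
Proof.
move=> cf.
have [[x0 fx0]|f0] := pselect (exists x, f x != 0); last first.
  exists 0 => x; rewrite inner0r; apply/eqP/negPn/negP => fx.
  by apply: f0; exists x.
(* The hyperplane is written as a preimage of the degenerate ball of radius 0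
   about 1, for which closedness and convexity are already available. *)
have clD : closed [set x | `|f x - 1| <= 0].
  exact: (closed_dist_le (V := R^o)).
have [|x Dx xP] := nearest_point 0 clD (@convex_preimage_ball _ _ _ f 1 0).
  exists ((f x0)^-1 *: x0) => /=.
  by rewrite linearZ /= /GRing.scale /= mulVf // subrr normr0.
have fx : f x = 1 by apply/eqP; rewrite -subr_eq0 -normr_le0.
have ortho h : f h = 0 -> inner h x = 0.
  have half k : f k = 0 -> 0 <= inner k x.
    move=> fk; have /xP : `|f (x + k) - 1| <= 0.
      by rewrite linearD fx fk addr0 subrr normr0.
    by rewrite sub0r addrAC subrr add0r innerNl oppr_le0 innerC.
  move=> fh; apply/le_anti; rewrite half // andbT.
  by have := half (- h); rewrite linearN fh oppr0 innerNl oppr_ge0; apply.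
have xx0 : inner x x != 0.
  rewrite inner_eq0; apply: contra_eq_neq fx => ->.
  by rewrite linear0 eq_sym oner_eq0.
exists ((inner x x)^-1 *: x) => y.
have : inner (y - f y *: x) x = 0.
  apply: ortho; rewrite linearB linearZ /= fx.
  by rewrite /GRing.scale /= mulr1 subrr.
rewrite innerBl innerZl innerZr => /eqP; rewrite subr_eq0 => /eqP ->.
by rewrite mulrC mulfK.
Qed.

End NearestPoint.

(** * The adjoint, and images of bounded closed convex sets *)

Lemma adjoint_inner (R : realType) (X Y : hilbertType R) (A : {linear X -> Y}) :
  bounded_operator A ->
  forall x y, inner (A x) y = inner x (adjoint A y).
Proof.
move=> hA x y.
have lin : linear (fun x : X => inner (A x) y : R^o).
  by move=> a u v; rewrite linearP innerDl innerZl.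
pose f : {linear X -> R^o} := HB.pack (fun x : X => inner (A x) y : R^o)
  (GRing.isLinear.Build _ _ _ _ _ lin).
have [|z zP] := riesz_representation (f := f).
  move=> u; apply: (@continuous_comp _ _ _ A (fun v => inner v y)).
    exact: bounded_operator_continuous.
  exact: inner_continuous.
rewrite /adjoint; case: xgetP => [w _ wP|/(_ z)[]]; [exact: wP | exact: zP].
Qed.

(** For [b] in the closure, the sets of the points of [K] whose image is within
    [1 / n.+1] of [b] decrease to the fibre of [b] in [K]; they are nonempty,
    closed and convex, so the fibre is nonempty too. *)
Lemma closed_image (R : realType) (X Y : hilbertType R) (A : {linear X -> Y})
    (K : set X) :
  bounded_operator A -> bounded_set K -> closed K -> convex_set K ->
  closed (A @` K).
Proof.
move=> hA /ex_strict_bound_gt0[M _ KM] clK cK b clb.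
have cA := bounded_operator_continuous hA.
pose C n := K `&` [set x | `|A x - b| <= n.+1%:R^-1].
have [||||x Cx _] := @nearest_point_decreasing _ _ C 0 M.
- by move=> n; apply: closedI => //; exact: closed_dist_le.
- by move=> n; apply: convex_setI => //; exact: convex_preimage_ball.
- move=> n x [Kx /= Ax]; split=> //; apply: le_trans Ax _.
  by rewrite lef_pV2 ?posrE // ler_nat.
- move=> n.
  have n0 : 0 < n.+1%:R^-1 :> R by rewrite invr_gt0.
  have [_ [[x Kx <-] Ax]] := clb _ (nbhsx_ballx b _ n0).
  exists x; last by rewrite subr0; exact: ltW (KM x Kx).
  by split=> //=; rewrite distrC ltW //; move: Ax; rewrite -ball_normE.
exists x; first by case: (Cx 0%N).
apply/eqP; rewrite -subr_eq0 -normr_le0; apply/ler_addgt0Pr => e e0.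
rewrite add0r.
have [n _ hn] := near_infty_natSinv_lt (PosNum e0).
case: (Cx n) => _ /= h; apply: le_trans h (ltW _); exact: hn n (leqnn n).
Qed.

(** * The support function and the polar cone *)

Section Support.
Variables (R : realType) (V : hilbertType R) (K : set V).
Implicit Types x v : V.

Lemma le_support_fun x v : bounded_set K -> K v -> inner x v <= support_fun K x.
Proof.
move=> /ex_strict_bound_gt0[M _ KM] Kv; apply: ub_le_sup; last by exists v.
exists (`|x| * M) => _ [w Kw <-]; apply: le_trans (cauchy_schwarz _ _) _.
by apply: ler_wpM2l => //; exact: ltW (KM w Kw).
Qed.

Lemma support_fun_le x (c : R) :
  K !=set0 -> (forall v, K v -> inner x v <= c) -> support_fun K x <= c.
Proof.
move=> [w Kw] h; apply: ge_sup; first by exists (inner x w), w.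
by move=> _ [v Kv <-]; exact: h.
Qed.

Lemma support_fun_ge0 x : bounded_set K -> K 0 -> 0 <= support_fun K x.
Proof. by move=> bK K0; rewrite -(inner0r x); exact: le_support_fun. Qed.

Lemma sub_cone : K `<=` cone K.
Proof. by move=> c Kc; exists 1, c; rewrite scale1r. Qed.

Lemma support_fun_eq0 x :
  bounded_set K -> K 0 -> support_fun K x = 0 <-> polar (cone K) x.
Proof.
move=> bK K0; split=> [s0 _ [l [c [l0 Kc ->]]] | xP].
  by rewrite innerZr mulr_ge0_le0 // -s0; exact: le_support_fun.
apply/le_anti; rewrite support_fun_ge0 // andbT.
by apply: support_fun_le => [|v Kv]; [exists 0 | exact/xP/sub_cone].
Qed.

(** Multiples of a point of the cone stay in the cone, so a linear form that is
    positive somewhere on the cone is unbounded above there. *)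
Lemma polar_cone_of_bounded x (c : R) :
  (forall v, cone K v -> inner x v <= c) -> polar (cone K) x.
Proof.
move=> h v Pv; rewrite leNgt; apply/negP => xv.
have [l [w [l0 Kw vE]]] := Pv.
have [r r0 rE] : exists2 r, 0 <= r & r * inner x v = `|c| + 1.
  exists ((`|c| + 1) / inner x v); last by rewrite divfK ?gt_eqF.
  by rewrite divr_ge0 ?addr_ge0 // ltW.
have /h : cone K (r *: v).
  exists (r * l), w; split=> //; first exact: mulr_ge0.
  by rewrite vE scalerA.
by rewrite innerZr rE leNgt (le_lt_trans (ler_norm c)) ?ltrDl.
Qed.

End Support.

(** * Farkas-type criteria *)

Theorem theorem1p3 (R : realType) (X Y : hilbertType R)
    (A : {linear X -> Y}) (hA : bounded_operator A)
    (K : set X) (hKb : bounded_set K) (hKcl : closed K)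
    (hKcv : convex_set K) (hK0 : K 0) (b : Y) :
  [<-> closure (A @` cone K) b;
       forall y : Y, support_fun K (adjoint A y) = 0 -> inner b y <= 0;
       forall y : Y, polar (cone K) (adjoint A y) -> inner b y <= 0]
  /\
  ((A @` cone K) b <->
   exists C : R, 0 < C /\
     forall y : Y, inner b y <= C * support_fun K (adjoint A y)).
Proof.
have adjE := adjoint_inner hA; have Kn0 : K !=set0 by exists 0.
have AP0 : (A @` cone K) !=set0 by exists (A 0), 0 => //; exact: sub_cone.
split.
  tfae=> [clb y /(support_fun_eq0 _ hKb hK0) yP | h y | h].
  - suff : closure (A @` cone K) `<=` [set z | inner z y <= 0] by exact.
    have /closure_id -> : closed [set z : Y | inner z y <= 0].
      by apply: closed_sublevel; exact: inner_continuous.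
    apply: closureS => _ [v Pv <-] /=.
    by rewrite adjE innerC; exact: yP.
  - by move=> /(support_fun_eq0 _ hKb hK0); exact: h.
  - apply: contrapT => nb.
    have cvP := convex_closure (convex_image (f := A) (convex_cone hKcv)).
    have clP : closed (closure (A @` cone K)) by exact: closed_closure.
    have [|y [c [cb yP]]] := separation clP cvP _ nb.
      by case: AP0 => z Pz; exists z; exact: subset_closure.
    have c0 : 0 <= c.
      have : closure (A @` cone K) 0.
        apply: subset_closure; exists 0; rewrite ?linear0 //.
        exact: sub_cone.
      by move=> /yP; rewrite innerC inner0r.
    have : inner b y <= 0.
      apply/h/(@polar_cone_of_bounded _ _ _ _ c) => v Pv.
      by rewrite innerC -adjE; apply/yP/subset_closure; exists v.
    by rewrite leNgt (le_lt_trans c0 cb).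
split=> [[_ [l [v [l0 Kv ->]]] <-] | [C [C0 hC]]].
  (* The constant must be positive, whereas [l] may vanish. *)
  exists (l + 1); split=> [|y]; first exact: ltr_wpDl.
  rewrite adjE innerZl innerC; have s0 := support_fun_ge0 (adjoint A y) hKb hK0.
  apply: (@le_trans _ _ (l * support_fun K (adjoint A y))).
    by rewrite ler_wpM2l //; exact: le_support_fun.
  by rewrite ler_wpM2r // lerDl.
suff [v Kv Av] : (A @` K) (C^-1 *: b).
  exists (C *: v); first by exists C, v; rewrite (ltW C0).
  by rewrite linearZ /= Av scalerA divff ?scale1r // gt_eqF.
apply: contrapT => nb.
have [|y [c [cb yP]]] := separation (closed_image hA hKb hKcl hKcv)
  (convex_image (f := A) hKcv) _ nb.
  by exists (A 0), 0.
have sc : support_fun K (adjoint A y) <= c.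
  apply: support_fun_le => // v Kv; rewrite innerC -adjE.
  by apply: yP; exists v.
have : inner b y <= C * c by apply: le_trans (hC y) _; rewrite ler_pM2l.
by rewrite leNgt -ltr_pdivlMl // -innerZl cb.
Qed.
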